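(* Let $X=\ell_q$ (complex) with $1\le q<\infty$. Then a typical $T\in(\mathcal{P}_1(X),\mathrm{SOT})$ does not satisfy the AAB criterion. If $1<q<\infty$, then a typical $T\in(\mathcal{P}_1(X),\mathrm{SOT}^* )$ does not satisfy the AAB criterion.
   Context: $X=\ell_q=\ell_q(\mathbb{Z}_+)$ is equipped with its canonical basis $(e_n)_{n\ge0}$. A vector is positive if all its coordinates are $\ge0$; a bounded operator $T$ on $X$ is positive if it maps positive vectors to positive vectors. $\mathcal{P}_1(X)$ is the set of bounded positive operators with $\|T\|\le1$. $\mathrm{SOT}$: $T_i\to T$ iff $\|T_ix-Tx\|\to0$ for every $x\in X$. $\mathrm{SOT}^*$: $T_i\to T$ iff $\|T_ix-Tx\|\to0$ for every $x\in X$ and $\|T_i^*x^*-T^*x^*\|\to0$ for every $x^*\in X^*$. ''A typical $T\in(\mathcal{P}_1(X),\tau)$ has property (P)'' means that the set of $T\in\mathcal{P}_1(X)$ with (P) is comeager, i.e. contains a dense $G_\delta$ subset of $(\mathcal{P}_1(X),\tau)$. An operator $A$ is quasinilpotent at $x$ if $\lim_{n}\|A^nx\|^{1/n}=0$. A positive operator $T$ satisfies the AAB (Abramovich–Aliprantis–Burkinshaw) criterion if there exists a non-zero bounded positive operator $A$ on $X$ with $AT=TA$ which is quasinilpotent at some non-zero positive vector of $X$. *)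

(* Defs.v *)
From HB Require Import structures.
From mathcomp Require Import all_boot all_order all_algebra.
From mathcomp Require Import all_classical all_reals all_analysis.
From mathcomp Require Import borel_hierarchy complex.

Set Implicit Arguments.
Unset Strict Implicit.
Unset Printing Implicit Defensive.

Import Order.TTheory GRing.Theory Num.Theory.
Import numFieldNormedType.Exports.

Local Open Scope classical_set_scope.
Local Open Scope ring_scope.
Local Open Scope complex_scope.

(* Norms of normed modules over R[i] are elements of R[i] (nonnegative for the
   order of R[i], hence real); [rnorm x] is the norm of [x] as an element of R. *)
Definition rnorm {R : realType} {V : normedZmodType R[i]} (x : V) : R :=
  complex.Re `|x|.

Section rnorm_theory.
Context {R : realType} {V : normedZmodType R[i]}.
Implicit Types x y : V.

Lemma rnormE x : `|x| = (rnorm x)%:C.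
Proof.
rewrite /rnorm; have := normr_ge0 x.
by case: `|x| => a b; rewrite lecE /= => /andP[/eqP -> _].
Qed.

Lemma rnorm_ge0 x : 0 <= rnorm x.
Proof. by rewrite -ler0c -rnormE normr_ge0. Qed.

Lemma ler_rnormD x y : rnorm (x + y) <= rnorm x + rnorm y.
Proof. by rewrite -lecR rmorphD /= -!rnormE ler_normD. Qed.

Lemma rnorm0 : rnorm (0 : V) = 0.
Proof. by rewrite /rnorm normr0. Qed.

Lemma rnorm_eq0 x : rnorm x = 0 -> x = 0.
Proof. by move=> x0; apply/normr0_eq0; rewrite rnormE x0. Qed.

End rnorm_theory.

Lemma rnormM {R : realType} (a b : R[i]) : rnorm (a * b) = rnorm a * rnorm b.
Proof. by apply: complexI; rewrite rmorphM /= -!rnormE normrM. Qed.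

Lemma rnorm1 {R : realType} : rnorm (1 : R[i]) = 1.
Proof. by rewrite /rnorm normr1. Qed.

Lemma ger0_rnorm {R : realType} (r : R) : 0 <= r -> rnorm (r%:C : R[i]) = r.
Proof. by move=> r0; rewrite /rnorm ger0_norm ?ler0c. Qed.

Lemma rnormZ {R : realType} {V : normedModType R[i]} (a : R[i]) (x : V) :
  rnorm (a *: x) = rnorm a * rnorm x.
Proof. by apply: complexI; rewrite rmorphM /= -!rnormE normrZ. Qed.

Section ellq_def.
Context {R : realType} (q : R).

Definition lqnorm (x : nat -> R[i]) : \bar R :=
  ('N[counting]_(q%:E)[EFin \o (fun n => rnorm (x n))])%E.

Definition lqpred : {pred nat -> R[i]} := mem [set x | (lqnorm x < +oo)%E].

End ellq_def.

Section lqnorm_theory.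
Context {R : realType} (q : R) (q1 : 1 <= q).
Implicit Types x y : nat -> R[i].

Let q0 : 0 < q.
Proof. exact: lt_le_trans q1. Qed.

Lemma lqnormE x :
  lqnorm q x = ((\sum_(k <oo) (rnorm (x k) `^ q)%:E) `^ q^-1)%E.
Proof.
rewrite /lqnorm Lnorm_counting//; congr (_ `^ _)%E.
by apply: eq_eseriesr => k _ /=; rewrite ger0_norm// rnorm_ge0.
Qed.

Lemma lqnorm_ge0 x : (0 <= lqnorm q x)%E.
Proof. exact: Lnorm_ge0. Qed.

Lemma lqnorm0 : lqnorm q 0 = 0%E.
Proof.
rewrite lqnormE eseries0 ?poweR0r ?invr_neq0 ?gt_eqF// => k _ _.
by rewrite [X in rnorm X](_ : _ = 0)// rnorm0 powR0// gt_eqF.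
Qed.

Lemma le_lqnormD x y : (lqnorm q (x + y)%R <= lqnorm q x + lqnorm q y)%E.
Proof.
apply: (@le_trans _ _ ('N[counting]_(q%:E)
    [EFin \o ((fun n => rnorm (x n)) \+ (fun n => rnorm (y n)))%R])%E); last first.
  by apply: eminkowski; rewrite ?lee_fin.
have nonneg (F : nat -> R) : (0 <= \sum_(k <oo) (F k `^ q)%:E)%E.
  by apply: nneseries_ge0 => k _ _; rewrite lee_fin powR_ge0.
rewrite lqnormE Lnorm_counting//.
apply: gt0_ler_poweR; rewrite ?invr_ge0 ?(ltW q0)//.
- by rewrite in_itv/= leey andbT.
- by rewrite in_itv/= leey andbT.
apply: lee_nneseries => k _; first by move=> _; rewrite lee_fin powR_ge0.
rewrite /= lee_fin ge0_ler_powR ?nnegrE ?rnorm_ge0 ?(ltW q0)//.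
rewrite ger0_norm ?addr_ge0 ?rnorm_ge0//; exact: ler_rnormD.
Qed.

Lemma lqnormZ a x : lqnorm q (a *: x) = ((rnorm a)%:E * lqnorm q x)%E.
Proof.
rewrite !lqnormE.
under eq_eseriesr => k _.
  rewrite [X in rnorm X](_ : _ = a * x k)// rnormM powRM ?rnorm_ge0// EFinM.
  over.
have nonneg : (0 <= \sum_(k <oo) (rnorm (x k) `^ q)%:E)%E.
  by apply: nneseries_ge0 => k _ _; rewrite lee_fin powR_ge0.
rewrite nneseriesZl; last by move=> k _; rewrite lee_fin powR_ge0.
rewrite poweRM// ?lee_fin ?powR_ge0//.
by rewrite poweR_EFin -powRrM mulfV ?gt_eqF// powRr1 ?rnorm_ge0.
Qed.

Lemma lqnorm_eq0 x : lqnorm q x = 0%E -> x = 0.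
Proof.
have s0 : (0 <= \sum_(k <oo) (rnorm (x k) `^ q)%:E)%E.
  by apply: nneseries_ge0 => k _ _; rewrite lee_fin powR_ge0.
rewrite lqnormE => /(poweR_eq0_eq0 s0) sE; apply/funext => n.
apply: rnorm_eq0.
have : (\sum_(0 <= k < n.+1) (rnorm (x k) `^ q)%:E <=
        \sum_(k <oo) (rnorm (x k) `^ q)%:E)%E.
  by apply: nneseries_lim_ge => k _; rewrite lee_fin powR_ge0.
rewrite sE big_nat_recr//= => h.
have : (((rnorm (x n) `^ q)%:E) <= 0)%E.
  apply: le_trans h; rewrite leeDr// sume_ge0// => k _.
  by rewrite lee_fin powR_ge0.
rewrite lee_fin => h0.
have := le_anti (introT andP (conj h0 (powR_ge0 _ _))).
by move=> /eqP; rewrite powR_eq0 => /andP[/eqP].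
Qed.

Lemma lqpred_submod_closed : submod_closed (@lqpred R q).
Proof.
split; first by rewrite inE /= lqnorm0.
move=> a x y; rewrite !inE /= => xq yq.
rewrite (le_lt_trans (le_lqnormD _ _))// lte_add_pinfty// lqnormZ.
by rewrite lte_mul_pinfty// ?lee_fin ?rnorm_ge0.
Qed.

End lqnorm_theory.

(* The complex space l_q; the proof of [1 <= q] is part of the type because the
   algebraic and normed structures depend on it. *)
Record ellq (R : realType) (q : R) (q1 : 1 <= q) := Ellq {
  ellq_val :> nat -> R[i];
  ellq_prop : ellq_val \in lqpred q }.

Section ellq_structures.
Context {R : realType} (q : R) (q1 : 1 <= q).

HB.instance Definition _ := [isSub for @ellq_val R q q1].
HB.instance Definition _ := [Choice of ellq q1 by <:].
HB.instance Definition _ :=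
  GRing.isSubmodClosed.Build _ _ (@lqpred R q) (lqpred_submod_closed q1).
HB.instance Definition _ := [SubChoice_isSubLmodule of ellq q1 by <:].

Definition ellq_norm (x : ellq q1) : R := fine (lqnorm q x).

Lemma ellq_normE (x : ellq q1) : (ellq_norm x)%:E = lqnorm q x.
Proof.
rewrite fineK// fin_numElt (lt_le_trans ltNy0) ?lqnorm_ge0//=.
by have := ellq_prop x; rewrite inE.
Qed.

Let ellq_normc (x : ellq q1) : R[i] := (ellq_norm x)%:C.

Let ler_ellq_normD x y : ellq_normc (x + y) <= ellq_normc x + ellq_normc y.
Proof.
rewrite -rmorphD lecR -lee_fin EFinD !ellq_normE.
exact: le_lqnormD.
Qed.

Let ellq_normZ (a : R[i]) x : ellq_normc (a *: x) = `|a| * ellq_normc x.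
Proof.
rewrite rnormE -rmorphM; congr (_%:C); apply: EFin_inj.
by rewrite EFinM !ellq_normE -lqnormZ.
Qed.

Let ellq_norm_eq0 x : ellq_normc x = 0 -> x = 0.
Proof.
move=> /complexI x0; apply: val_inj => /=; apply: (@lqnorm_eq0 _ q q1).
by rewrite -ellq_normE x0.
Qed.

HB.instance Definition _ := Lmodule_isNormed.Build R[i] (ellq q1)
  ler_ellq_normD ellq_normZ ellq_norm_eq0.

Lemma ellq_rnormE (x : ellq q1) : rnorm x = ellq_norm x.
Proof. by []. Qed.

End ellq_structures.

Section bounded_operators.
Context {R : realType} (V W : normedModType R[i]).

Definition boundedOp_pred : {pred V -> W} := mem [set f : V -> W |
  linear f /\ exists M : R, forall x, rnorm (f x) <= M * rnorm x].

Definition opnorm (f : V -> W) : R :=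
  sup [set rnorm (f x) | x in [set x | rnorm x <= 1]].

Lemma boundedOp_pred_submod_closed : submod_closed boundedOp_pred.
Proof.
split.
  rewrite inE /=; split.
    by move=> a x y; rewrite /= /GRing.zero/= scaler0 addr0.
  by exists 0 => x; rewrite mul0r [X in rnorm X](_ : _ = 0)// rnorm0.
move=> a f g; rewrite !inE /= => -[lf [M Mf]] [lg [N Ng]]; split.
  move=> b x y; rewrite !fctE lf lg; rewrite !scalerDr !scalerA (mulrC a b).
  by rewrite addrACA.
exists (rnorm a * M + N) => x.
apply: (le_trans (ler_rnormD _ _)); rewrite mulrDl lerD//.
by rewrite rnormZ -mulrA ler_wpM2l// rnorm_ge0.
Qed.

Record boundedOp := BoundedOp { boundedOp_fun :> V -> W; boundedOp_prop : boundedOp_fun \in boundedOp_pred }.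

HB.instance Definition _ := [isSub for boundedOp_fun].
HB.instance Definition _ := [Choice of boundedOp by <:].
HB.instance Definition _ :=
  GRing.isSubmodClosed.Build _ _ boundedOp_pred boundedOp_pred_submod_closed.
HB.instance Definition _ := [SubChoice_isSubLmodule of boundedOp by <:].

Lemma boundedOp_linear (f : boundedOp) : linear f.
Proof. by have := boundedOp_prop f; rewrite inE => -[]. Qed.

HB.instance Definition _ (f : boundedOp) :=
  GRing.isLinear.Build R[i] V W _ (boundedOp_fun f) (@boundedOp_linear f).

Lemma opnorm_has_sup (f : boundedOp) :
  has_sup [set rnorm (f x) | x in [set x | rnorm x <= 1]].
Proof.
split; first by exists (rnorm (f 0)), 0 => //=; rewrite rnorm0.
have := boundedOp_prop f; rewrite inE => -[_ [M Mf]].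
exists (Num.max M 0) => _ [x /= x1 <-]; apply: (le_trans (Mf x)).
have [M0|M0] := leP M 0.
  by rewrite (le_trans _ (lexx 0))// mulr_le0_ge0// rnorm_ge0.
by rewrite -[leRHS]mulr1 ler_wpM2l// ltW.
Qed.

Lemma opnorm_ge0 (f : boundedOp) : 0 <= opnorm f.
Proof.
have [_ ub] := opnorm_has_sup f.
apply: (ub_le_sup ub); exists 0; first by rewrite /= rnorm0.
by rewrite linear0 rnorm0.
Qed.

Lemma le_opnorm (f : boundedOp) x : rnorm (f x) <= opnorm f * rnorm x.
Proof.
have [->|x0] := eqVneq x 0; first by rewrite linear0 !rnorm0 mulr0.
have rx0 : 0 < rnorm x.
  rewrite lt_neqAle rnorm_ge0 andbT eq_sym; apply: contra x0 => /eqP.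
  by move=> /rnorm_eq0 ->.
have [_ ub] := opnorm_has_sup f.
rewrite -ler_pdivrMr//; apply: (ub_le_sup ub); exists ((rnorm x)^-1%:C *: x).
  rewrite /= rnormZ [rnorm _]ger0_rnorm ?invr_ge0 ?rnorm_ge0//.
  by rewrite mulVf// gt_eqF.
rewrite linearZ rnormZ [rnorm _%:C]ger0_rnorm ?invr_ge0 ?rnorm_ge0//.
by rewrite mulrC.
Qed.

Lemma opnorm_le (f : boundedOp) (M : R) : 0 <= M ->
  (forall x, rnorm (f x) <= M * rnorm x) -> opnorm f <= M.
Proof.
move=> M0 Mf; apply: ge_sup; first by case: (opnorm_has_sup f).
move=> _ [x /= x1 <-]; apply: (le_trans (Mf x)).
by rewrite -[leRHS]mulr1 ler_wpM2l.
Qed.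

Let opnormc (f : boundedOp) : R[i] := (opnorm f)%:C.

Let ler_opnormD f g : opnormc (f + g) <= opnormc f + opnormc g.
Proof.
rewrite -rmorphD lecR; apply: opnorm_le; first by rewrite addr_ge0 ?opnorm_ge0.
move=> x; apply: (le_trans (ler_rnormD _ _)).
by rewrite mulrDl lerD ?le_opnorm.
Qed.

Let opnorm_leZ (a : R[i]) (f : boundedOp) : opnorm (a *: f) <= rnorm a * opnorm f.
Proof.
apply: opnorm_le; first by rewrite mulr_ge0 ?rnorm_ge0 ?opnorm_ge0.
by move=> x; rewrite rnormZ -mulrA ler_wpM2l ?rnorm_ge0 ?le_opnorm.
Qed.

Let opnormZ (a : R[i]) f : opnormc (a *: f) = `|a| * opnormc f.
Proof.
rewrite rnormE -rmorphM; congr (_%:C); apply/eqP.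
rewrite eq_le opnorm_leZ andTb.
have [->|a0] := eqVneq a 0; first by rewrite rnorm0 mul0r opnorm_ge0.
have ra0 : 0 < rnorm a.
  rewrite lt_neqAle rnorm_ge0 andbT eq_sym; apply: contra a0 => /eqP.
  by move=> /rnorm_eq0 ->.
rewrite -ler_pdivlMl//.
have -> : (rnorm a)^-1 = rnorm a^-1.
  by apply: (mulfI (lt0r_neq0 ra0)); rewrite -rnormM (mulfV a0) mulfV ?rnorm1 ?gt_eqF.
by rewrite -[in leLHS](scalerK a0 f) opnorm_leZ.
Qed.

Let opnorm_eq0 f : opnormc f = 0 -> f = 0.
Proof.
move=> /complexI f0; apply: val_inj; apply/funext => x; apply: rnorm_eq0.
by apply/eqP; rewrite eq_le rnorm_ge0 andbT (le_trans (le_opnorm _ _))// f0 mul0r.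
Qed.

HB.instance Definition _ := Lmodule_isNormed.Build R[i] boundedOp
  ler_opnormD opnormZ opnorm_eq0.

Lemma boundedOp_rnormE (f : boundedOp) : rnorm f = opnorm f.
Proof. by []. Qed.

End bounded_operators.

Section operator_topologies.
Context {R : realType} (V W : normedModType R[i]).

Definition dual_space (X : normedModType R[i]) := boundedOp X R[i]^o.

Lemma adjoint_subproof (T : boundedOp V W) (phi : dual_space W) :
  (phi \o T : V -> R[i]^o) \in @boundedOp_pred R V R[i]^o.
Proof.
rewrite inE; split; first by move=> a x y; rewrite /= !linearP.
exists (opnorm phi * opnorm T) => x; apply: (le_trans (le_opnorm _ _)).
by rewrite -mulrA ler_wpM2l ?opnorm_ge0 ?le_opnorm.
Qed.

Definition adjoint (T : boundedOp V W) (phi : dual_space W) : dual_space V :=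
  BoundedOp (adjoint_subproof T phi).

(* SOT is the coarsest topology making all maps T |-> T x continuous; SOT* is
   the coarsest one making moreover all maps T |-> T^* phi continuous, for the
   norm topology of the dual. *)
Definition SOT : Type :=
  initial_topology (fun T : boundedOp V W => (T : V -> W) : {ptws V -> W}).

Definition SOTstar : Type :=
  initial_topology (fun T : boundedOp V W =>
    ((T : V -> W) : {ptws V -> W},
     adjoint T : {ptws dual_space W -> dual_space V})).

HB.instance Definition _ := Topological.on SOT.
HB.instance Definition _ := Topological.on SOTstar.

Lemma cvg_initialP (S : choiceType) (T : topologicalType) (f : S -> T)
    (F : set_system (initial_topology f)) (s : initial_topology f) :
  Filter F -> F --> s <-> f @ F --> f s.
Proof.
move=> FF; split.
  by move=> h; exact: cvg_trans (cvg_app f h) (@initial_continuous _ _ f s).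
move=> h A [B [[C oC <-] Cs]] BA.
have := h C (open_nbhs_nbhs (conj oC Cs)).
by apply: (@filterS _ F) => x; exact: BA.
Qed.

Lemma cvg_SOTP (F : set_system SOT) (T : SOT) : Filter F ->
  F --> T <-> forall x, (S : boundedOp V W) x @[S --> F] --> (T : boundedOp V W) x.
Proof.
move=> FF; rewrite cvg_initialP; apply: iff_trans.
  exact: (@pointwise_cvgP _ _ _ (boundedOp_fun T)).
by [].
Qed.

Lemma cvg_productP (I : Type) (S T : topologicalType) (F : set_system I)
    (f : I -> S) (g : I -> T) (a : S) (b : T) : Filter F ->
  (f x, g x) @[x --> F] --> (a, b) <-> (f @ F --> a) /\ (g @ F --> b).
Proof.
move=> FF; split=> [h|[h1 h2]]; last exact: cvg_pair.
split; first exact: cvg_trans (cvg_app fst h) cvg_fst.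
exact: cvg_trans (cvg_app snd h) cvg_snd.
Qed.

Lemma cvg_SOTstarP (F : set_system SOTstar) (T : SOTstar) : Filter F ->
  F --> T <->
  (forall x, (S : boundedOp V W) x @[S --> F] --> (T : boundedOp V W) x) /\
  (forall phi, adjoint S phi @[S --> F] --> adjoint T phi).
Proof.
move=> FF; rewrite cvg_initialP.
have e0 := @cvg_productP SOTstar {ptws V -> W} {ptws dual_space W -> dual_space V}
  F (fun S => boundedOp_fun S) (fun S => adjoint S) (boundedOp_fun T)
  (adjoint T) FF.
have e1 := @pointwise_cvgP V W ((fun S : SOTstar => boundedOp_fun S) @ F)
  (boundedOp_fun T) _.
have e2 := @pointwise_cvgP (dual_space W) (dual_space V)
  ((fun S : SOTstar => adjoint S) @ F) (adjoint T) _.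
apply: (iff_trans e0).
by split=> -[h1 h2]; (split; [apply/e1|apply/e2]).
Qed.

End operator_topologies.

Definition comeager {T : topologicalType} (A : set T) : Prop :=
  exists G : set T, [/\ Gdelta G, dense G & G `<=` A].

Section positive_operators.
Context {R : realType} (q : R) (q1 : 1 <= q).
Local Notation X := (ellq q1).

(* For the order of R[i], [0 <= z] means that z is real and nonnegative. *)
Definition positive_vec (x : X) : Prop := forall n : nat, 0 <= x n.

Definition positive_op (T : boundedOp X X) : Prop :=
  forall x, positive_vec x -> positive_vec (T x).

Definition P1 : set (boundedOp X X) := [set T | positive_op T /\ rnorm T <= 1].

Definition quasinilpotent_at (A : boundedOp X X) (x : X) : Prop :=
  (rnorm (iter n A x) `^ n%:R^-1) @[n --> \oo] --> (0 : R).

Definition AAB (T : boundedOp X X) : Prop :=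
  exists A : boundedOp X X, [/\ A != 0, positive_op A, A \o T = T \o A &
    exists x : X, [/\ x != 0, positive_vec x & quasinilpotent_at A x]].

Definition P1_SOT : Type := set_type (P1 : set (SOT X X)).
Definition P1_SOTstar : Type := set_type (P1 : set (SOTstar X X)).

HB.instance Definition _ := Topological.on P1_SOT.
HB.instance Definition _ := Topological.on P1_SOTstar.

End positive_operators.

(* Main.v *)
Require Import Defs.
From HB Require Import structures.
From mathcomp Require Import all_boot all_order all_algebra.
From mathcomp Require Import all_classical all_reals all_analysis.
From mathcomp Require Import complex.

(** The set that is shown to be comeager consists of the positive contractions
    T whose matrix has no zero on the two diagonals next to the main one, the
    same set for both topologies.

    It consists of operators failing the AAB criterion ([linked_not_AAB]).  For
    such a T, every nonzero positive vector acquires a positive coordinate at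
    any prescribed place after enough applications of T ([linked_reach]).  Let
    A be nonzero, positive, commuting with T, and let x be positive and nonzero.
    Some [A e_j] is nonzero, so some power [T^N] makes the diagonal coefficient
    d of [T^N A] at j positive, and some power [T^M] makes the coordinate c of
    [T^M x] at j positive.  The operator [T^N A] being positive, the coordinate
    at j of [(T^N A)^n T^M x] is at least [c d^n].  But this vector is
    [T^(nN+M) A^n x], whose norm is at most that of [A^n x] because T is a
    contraction.  So the n-th roots of the norms of [A^n x] do not tend to 0,
    and A is not quasinilpotent at x.

    It is a G_delta set because each matrix coefficient is a continuous function
    of T for the strong operator topology.  It is dense because half the sum of
    the two unilateral shifts belongs to it: any strict convex combination of
    this operator with an arbitrary positive contraction S again belongs to the
    set, and such combinations converge to S in norm, hence for both topologies
    ([comeager_not_AAB]). *)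

Set Implicit Arguments.
Unset Strict Implicit.
Unset Printing Implicit Defensive.

Import Order.TTheory GRing.Theory Num.Theory.
Import numFieldNormedType.Exports.

Local Open Scope classical_set_scope.
Local Open Scope ring_scope.
Local Open Scope complex_scope.

(** * Norms and coordinates in l_q *)

Lemma ler_rnorm {R : realType} {V W : normedZmodType R[i]} (x : V) (y : W) :
  (rnorm x <= rnorm y) = (`|x| <= `|y|).
Proof. by rewrite [`|x|]rnormE [`|y|]rnormE lecR. Qed.

Lemma boundedOpD {R : realType} (V W : normedModType R[i])
    (S T : boundedOp V W) x : (S + T) x = S x + T x.
Proof. by []. Qed.

Lemma boundedOpZ {R : realType} (V W : normedModType R[i]) a
    (T : boundedOp V W) x : (a *: T) x = a *: T x.
Proof. by []. Qed.

Lemma eq_ellq {R : realType} (q : R) (q1 : 1 <= q) (x y : ellq q1) :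
  x =1 y -> x = y.
Proof. by move=> xy; apply: val_inj; apply/funext. Qed.

Lemma ellqD {R : realType} (q : R) (q1 : 1 <= q) (x y : ellq q1) k :
  (x + y) k = x k + y k.
Proof. by []. Qed.

Lemma ellqN {R : realType} (q : R) (q1 : 1 <= q) (x : ellq q1) k :
  (- x) k = - x k.
Proof. by []. Qed.

Lemma ellqZ {R : realType} (q : R) (q1 : 1 <= q) a (x : ellq q1) k :
  (a *: x) k = a * x k.
Proof. by []. Qed.

Section ellq_norm_theory.
Context {R : realType} (q : R) (q1 : 1 <= q).
Local Notation X := (ellq q1).
Implicit Types (f g : nat -> R[i]) (x y : X).

(** The q-th power of the norm, without the outer exponent: all norm estimates
    below are comparisons of such sums. *)
Definition lqsum f : \bar R := (\sum_(k <oo) (rnorm (f k) `^ q)%:E)%E.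

Let term_ge0 f k : (0 <= (rnorm (f k) `^ q)%:E)%E.
Proof. by rewrite lee_fin powR_ge0. Qed.

Let q0 : 0 < q.
Proof. exact: lt_le_trans q1. Qed.

Let term0 : (rnorm (0 : R[i]) `^ q)%:E = 0%E.
Proof. by rewrite rnorm0 powR0// gt_eqF. Qed.

Lemma lqsum_ge0 f : (0 <= lqsum f)%E.
Proof. exact: nneseries_ge0. Qed.

Lemma le_lqnorm f g : (lqsum f <= lqsum g)%E -> (lqnorm q f <= lqnorm q g)%E.
Proof.
move=> fg; rewrite !lqnormE//.
by apply: gt0_ler_poweR => //; rewrite ?invr_ge0 ?(ltW q0)// in_itv/= leey
  andbT lqsum_ge0.
Qed.

Lemma lqpred_le f g : (lqsum f <= lqsum g)%E -> g \in lqpred q ->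
  f \in lqpred q.
Proof. by move=> /le_lqnorm fg; rewrite !inE/= => /(le_lt_trans fg). Qed.

Lemma rnorm_lqsum x : ((rnorm x `^ q)%:E = lqsum x)%E.
Proof.
rewrite ellq_rnormE -poweR_EFin ellq_normE lqnormE// -/(lqsum x).
have := lqsum_ge0 x; case: (lqsum x) => [r| |]//= r0.
  by rewrite -powRrM mulVf ?gt_eqF// powRr1.
by rewrite invr_eq0 gt_eqF//= gt_eqF.
Qed.

Lemma le_rnorm_lqsum x y : (lqsum x <= lqsum y)%E -> rnorm x <= rnorm y.
Proof. by move=> /le_lqnorm; rewrite -!ellq_normE lee_fin. Qed.

Lemma le_lqsum_coord f n : ((rnorm (f n) `^ q)%:E <= lqsum f)%E.
Proof.
rewrite /lqsum (@nneseriesD1 _ _ n)// leeDl//.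
exact: nneseries_ge0.
Qed.

Lemma le_coord x n : `|x n| <= `|x|.
Proof.
rewrite -ler_rnorm leNgt; apply/negP => xn.
have := le_lqsum_coord x n; rewrite -rnorm_lqsum lee_fin leNgt => /negP; apply.
by apply: gt0_ltr_powR; rewrite ?nnegrE ?rnorm_ge0.
Qed.

Definition basis_fun (j k : nat) : R[i] := (k == j)%:R.

Lemma basis_subproof j : basis_fun j \in lqpred q.
Proof.
rewrite inE/= lqnormE// poweR_lty//.
rewrite (nneseries_split _ j.+1)// eseries0 ?adde0.
  by rewrite add0n sumEFin ltry.
by move=> k jk _; rewrite /basis_fun gtn_eqF.
Qed.

Definition basis_vec j : X := Ellq q1 (basis_subproof j).

Definition tail_fun x (N k : nat) : R[i] := if (k < N)%N then 0 else x k.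

Lemma lqsum_tail x N :
  lqsum (tail_fun x N) = (\sum_(N <= k <oo) (rnorm (x k) `^ q)%:E)%E.
Proof.
rewrite /lqsum (nneseries_split _ N)// big_nat big1 ?add0n ?add0e.
  rewrite [LHS]eseries_cond [RHS]eseries_cond; apply: eq_eseriesr => k /=.
  by rewrite /tail_fun leqNgt => /negbTE ->.
by move=> k /andP[_]; rewrite /tail_fun => ->.
Qed.

Lemma tail_subproof x N : tail_fun x N \in lqpred q.
Proof.
apply: lqpred_le (ellq_prop x); rewrite lqsum_tail /lqsum.
by rewrite [leRHS](nneseries_split _ N)// add0n leeDr// sume_ge0.
Qed.

Definition tail x N : X := Ellq q1 (tail_subproof x N).

Lemma tailS x N : tail x N = x N *: basis_vec N + tail x N.+1.
Proof.
apply: eq_ellq => k; rewrite ellqD ellqZ/= /basis_fun /tail_fun ltnS.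
by case: ltngtP => // [_|_|->]; rewrite ?mulr0 ?mulr1 ?add0r ?addr0.
Qed.

Lemma tail_small x (e : R) : 0 < e -> exists N, rnorm (tail x N) < e.
Proof.
move=> e0; have eq0 : 0 < e `^ q by rewrite powR_gt0.
have := @nneseries_tail_cvg R (fun k => (rnorm (x k) `^ q)%:E) xpredT.
rewrite -/(lqsum x) -rnorm_lqsum ltry => /(_ isT (fun k _ => term_ge0 x k)).
move=> /fine_cvgP[_ /cvgrPdist_lt/(_ _ eq0)[N _ /(_ _ (leqnn N))]].
rewrite /= -lqsum_tail -(rnorm_lqsum (tail x N)) sub0r normrN/=.
rewrite ger0_norm ?powR_ge0// => h; exists N; rewrite ltNge; apply/negP => eN.
move: h; rewrite ltNge => /negP; apply.
by apply: ge0_ler_powR; rewrite ?nnegrE ?rnorm_ge0 ?(ltW e0) ?(ltW q0).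
Qed.

(** Removing the first N coordinates of x does not change [A x] when A kills the
    basis, and leaves a vector of arbitrarily small norm since q is finite. *)
Lemma basis_total (A : boundedOp X X) :
  (forall j, A (basis_vec j) = 0) -> A = 0.
Proof.
move=> A0; apply: val_inj; apply/funext => x; rewrite -[LHS]/(A x).
apply: rnorm_eq0.
have AN N : A x = A (tail x N).
  elim: N => [|N ->]; last by rewrite tailS linearP /= A0 scaler0 add0r.
  by congr (A _); apply: eq_ellq.
apply/eqP; rewrite eq_le rnorm_ge0 andbT; apply/ler_addgt0Pr => e e0.
rewrite add0r.
(* the added 1 allows dividing when A has norm 0 *)
have A1 : 0 < opnorm A + 1 by rewrite ltr_wpDl ?opnorm_ge0.
have [|N] := @tail_small x (e / (opnorm A + 1)); first by rewrite divr_gt0.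
rewrite ltr_pdivlMr// => /ltW; apply: le_trans.
rewrite (AN N) (le_trans (le_opnorm _ _))// mulrC ler_wpM2l ?rnorm_ge0//.
by rewrite lerDl.
Qed.

(** ** The unilateral shifts *)

Definition shiftr_fun x k : R[i] := if k is k'.+1 then x k' else 0.
Definition shiftl_fun x k : R[i] := x k.+1.

Lemma lqsum_shiftr x : (lqsum (shiftr_fun x) <= lqsum x)%E.
Proof.
rewrite /lqsum (nneseries_split _ 1)// big_nat1 term0 add0e add0n.
rewrite -nneseries_addn//; apply: lee_nneseries => // k _.
by rewrite addn1.
Qed.

Lemma lqsum_shiftl x : (lqsum (shiftl_fun x) <= lqsum x)%E.
Proof.
rewrite /lqsum [leRHS](nneseries_split _ 1)// add0n -nneseries_addn//.
rewrite -[leLHS]add0e leeD//; first by rewrite big_nat1.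
by apply: lee_nneseries => // k _; rewrite addn1.
Qed.

Definition shiftr x : X := Ellq q1 (lqpred_le (lqsum_shiftr x) (ellq_prop x)).
Definition shiftl x : X := Ellq q1 (lqpred_le (lqsum_shiftl x) (ellq_prop x)).

Lemma shiftr_subproof : shiftr \in @boundedOp_pred R X X.
Proof.
rewrite inE; split.
  move=> a x y; apply: eq_ellq => k; rewrite ellqD ellqZ.
  by case: k => [|k] //=; rewrite mulr0 addr0.
by exists 1 => x; rewrite mul1r le_rnorm_lqsum// lqsum_shiftr.
Qed.

Lemma shiftl_subproof : shiftl \in @boundedOp_pred R X X.
Proof.
rewrite inE; split; first by move=> a x y; apply: eq_ellq.
by exists 1 => x; rewrite mul1r le_rnorm_lqsum// lqsum_shiftl.
Qed.

Definition shiftr_op : boundedOp X X := BoundedOp shiftr_subproof.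
Definition shiftl_op : boundedOp X X := BoundedOp shiftl_subproof.

Lemma rnorm_shiftr : rnorm shiftr_op <= 1.
Proof.
by apply: opnorm_le => // x; rewrite mul1r le_rnorm_lqsum// lqsum_shiftr.
Qed.

Lemma rnorm_shiftl : rnorm shiftl_op <= 1.
Proof.
by apply: opnorm_le => // x; rewrite mul1r le_rnorm_lqsum// lqsum_shiftl.
Qed.

End ellq_norm_theory.

Arguments basis_vec {R q} q1 j.
Arguments shiftr_op {R q} q1.
Arguments shiftl_op {R q} q1.

(** * Operators linking neighbouring coordinates fail the AAB criterion *)

Lemma iter_commute (V : Type) (f g : V -> V) n v : g \o f = f \o g ->
  g (iter n f v) = iter n f (g v).
Proof.
move=> gf; elim: n => //= n <-.
by rewrite -[LHS]/((g \o f) _) gf.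
Qed.

(** If the roots tended to 0 they would eventually be below [d / 2], so that
    [c d^n] would be less than [(d / 2)^n], which fails for large n. *)
Lemma geometric_lower_bound {R : realType} (c d : R) (a : nat -> R) :
  0 < c -> 0 < d -> (forall n, c * d ^+ n <= a n) ->
  ~ ((a n `^ n%:R^-1) @[n --> \oo] --> (0 : R)).
Proof.
move=> c0 d0 cda a0.
have d20 : 0 < d / 2 by rewrite divr_gt0.
have : \forall n \near \oo,
    [/\ (0 < n)%N, a n `^ n%:R^-1 < d / 2 & 2^-1 ^+ n < c].
  near=> n; split.
  - by near: n; exists 1%N.
  - by near: n; exact: cvgr_lt a0 _ d20.
  - near: n; apply: cvgr_lt c0; apply: cvg_expr.
    by rewrite ger0_norm ?invr_ge0// invf_lt1// ltr1n.
move=> [N _ /(_ _ (leqnn N))[N0 aN cN]].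
have an0 : 0 <= a N by rewrite (le_trans _ (cda N))// mulr_ge0 ?exprn_ge0 ?ltW.
have : a N < (d / 2) ^+ N.
  rewrite -[ltLHS]powRr1// -[X in _ `^ X](@mulVf _ N%:R) ?pnatr_eq0 -?lt0n//.
  rewrite powRrM powR_mulrn ?powR_ge0//.
  by rewrite ltr_pXn2r ?nnegrE ?powR_ge0 ?(ltW d20).
apply/negP; rewrite -leNgt (le_trans _ (cda N))// exprMn mulrC.
by rewrite ler_wpM2r ?exprn_ge0 ?ltW.
Unshelve. all: by end_near. Qed.

Section linked.
Context {R : realType} (q : R) (q1 : 1 <= q).
Local Notation X := (ellq q1).
Local Notation e := (basis_vec q1).
Implicit Types (T A : boundedOp X X) (u v x : X).

Lemma positive_basis j : positive_vec (e j).
Proof. by move=> k; rewrite ler0n. Qed.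

Lemma positive_iter (f : X -> X) n :
  (forall v, positive_vec v -> positive_vec (f v)) ->
  forall v, positive_vec v -> positive_vec (iter n f v).
Proof. by move=> fP v vP; elim: n => //= n; exact: fP. Qed.

(** [v - v_j e_j] is positive because v is, and f preserves positivity; so a
    positive operator sends v at least as far as its j-th component alone. *)
Lemma positive_coord (f : X -> X) v i j : linear f ->
  (forall u, positive_vec u -> positive_vec (f u)) -> positive_vec v ->
  v j * f (e j) i <= f v i.
Proof.
move=> fl fP vP; have wP : positive_vec (v - v j *: e j).
  move=> k; rewrite ellqD ellqN ellqZ/= /basis_fun.
  by case: eqP => [->|_]; rewrite ?mulr1 ?subrr// mulr0 subr0.
rewrite -[in leRHS](subrK (v j *: e j) v) [_ - _ + _]addrC fl.
by rewrite ellqD ellqZ lerDl fP.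
Qed.

Lemma positive_gt0 v : positive_vec v -> v != 0 -> exists j, 0 < v j.
Proof.
move=> vP v0; apply: contrapT => vN; move/eqP: v0; apply.
apply: eq_ellq => j; apply/eqP; apply: contrapT => /negP vj.
by apply: vN; exists j; rewrite lt0r vj vP.
Qed.

(** Unlike the existence, for all i and j, of a power of T with nonzero (i, j)
    coefficient, which is what it serves to ensure, this condition only involves
    T itself; that makes it visibly a G_delta condition. *)
Definition neighbours_linked T :=
  forall i, (T (e i) i.+1 != 0) /\ (T (e i.+1) i != 0).

(** A positive coordinate propagates to each neighbouring place at each
    application of T: walk from k down to 0, then from 0 up to j. *)
Lemma linked_reach T v j : positive_op T -> neighbours_linked T ->
  positive_vec v -> v != 0 -> exists n, 0 < iter n T v j.
Proof.
move=> TP TL vP /(positive_gt0 vP)[k vk].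
have step i l n : T (e i) l != 0 -> 0 < iter n T v i -> 0 < iter n.+1 T v l.
  move=> Til vi; apply: (@lt_le_trans _ _ (iter n T v i * T (e i) l)).
    by rewrite mulr_gt0// lt0r Til TP//; exact: positive_basis.
  apply: positive_coord => //; first exact: boundedOp_linear.
  exact: positive_iter.
have [m vm] : exists n, 0 < iter n T v 0%N.
  (* the induction on k lets the number of steps already made vary *)
  suff H n : 0 < iter n T v k -> exists n, 0 < iter n T v 0%N by exact: (H 0%N).
  elim: k {vk} n => [n|k IH n] vk; first by exists n.
  by apply: (IH n.+1); apply: step vk; case: (TL k).
elim: j => [|j [n vj]]; first by exists m.
by exists n.+1; apply: step vj; case: (TL j).
Qed.

Lemma contraction_iter T n v : rnorm T <= 1 -> rnorm (iter n T v) <= rnorm v.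
Proof.
move=> T1; elim: n => //= n; apply: le_trans.
by rewrite (le_trans (le_opnorm _ _))// ler_piMl ?rnorm_ge0.
Qed.

(** [T^N A] has a positive diagonal coefficient d, so the coordinate at j of its
    powers applied to [T^M x] grows at least like [c d^n]; as T commutes with A
    and contracts norms, this bounds the norm of [A^n x] from below. *)
Lemma linked_not_AAB T : P1 T -> neighbours_linked T -> ~ AAB T.
Proof.
move=> [TP T1] TL [A [A0 AP AT [x [x0 xP]]]].
have iterP n v : positive_vec v -> positive_vec (iter n T v).
  exact: positive_iter.
have [j Aj] : exists j, A (e j) != 0.
  apply: contrapT => AN; move/eqP: A0; apply; apply: basis_total => j.
  by apply/eqP; apply: contrapT => /negP Aj; apply: AN; exists j.
have ejP : positive_vec (A (e j)) by exact/AP/positive_basis.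
have [N dN] := linked_reach j TP TL ejP Aj.
have [M cM] := linked_reach j TP TL xP x0.
pose B v := iter N T (A v).
have BP v : positive_vec v -> positive_vec (B v) by move=> vP; exact/iterP/AP.
have Bl : linear B.
  by move=> a u v; rewrite /B linearP; elim: (N) => //= n ->; rewrite linearP.
set d := iter N T _ _ in dN; set c := iter M T _ _ in cM.
have low n : c * d ^+ n <= iter n B (iter M T x) j.
  elim: n => [|n IH]; first by rewrite mulr1.
  rewrite exprSr mulrA (le_trans (ler_wpM2r (ltW dN) IH))//=.
  by apply: positive_coord => //; apply: positive_iter => //; exact: iterP.
have up n : rnorm (iter n B (iter M T x)) <= rnorm (iter n A x).
  have -> : iter n B (iter M T x) = iter (n * N + M) T (iter n A x).
    elim: n => [|n /= ->]//; rewrite /B iter_commute//.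
    by rewrite -iterD addnA mulSn.
  exact: contraction_iter.
apply: (@geometric_lower_bound R (rnorm c) (rnorm d)).
- by rewrite -ltcR -rnormE normr_gt0 gt_eqF.
- by rewrite -ltcR -rnormE normr_gt0 gt_eqF.
- move=> n; apply: le_trans (up n); rewrite -lecR rmorphM rmorphXn/=.
  rewrite -!rnormE (ger0_norm (ltW cM)) (ger0_norm (ltW dN)).
  apply: (le_trans (low n)); apply: le_trans (le_coord _ j).
  by rewrite real_ler_norm// ger0_real// positive_iter//; exact: iterP.
Qed.

End linked.

(** * Norm convergence, SOT and SOT* *)

Section operator_convergence.
Context {R : realType}.

Lemma cvg_rnorm {V : normedModType R[i]} {I : Type} (F : set_system I)
    {FF : Filter F} (f : I -> V) (l : V) :
  rnorm (l - f t) @[t --> F] --> (0 : R) -> f @ F --> l.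
Proof.
move=> fl; apply/cvgrPdist_lt => -[e1 e2]; rewrite ltcE/= => /andP[/eqP -> e0].
near=> t; rewrite rnormE ltcR; near: t; exact: cvgr_lt fl _ e0.
Unshelve. all: by end_near. Qed.

Lemma cvg0_rnorm_le {V W : normedModType R[i]} (u : nat -> V) (w : nat -> W)
    (M : R) :
  (forall n, rnorm (w n) <= M * rnorm (u n)) ->
  rnorm (u n) @[n --> \oo] --> (0 : R) -> rnorm (w n) @[n --> \oo] --> (0 : R).
Proof.
move=> wu u0; apply: (@squeeze_cvgr _ _ _ _ (cst 0) (fun n => M * rnorm (u n))).
- by near=> n; rewrite rnorm_ge0 wu.
- exact: cvg_cst.
- by rewrite -[X in _ --> X](mulr0 M); apply: cvgMr.
Unshelve. all: by end_near. Qed.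

Lemma cvg_norm_SOT (V W : normedModType R[i]) (T : boundedOp V W)
    (S : nat -> boundedOp V W) :
  rnorm (T - S n) @[n --> \oo] --> (0 : R) ->
  (S n : SOT V W) @[n --> \oo] --> (T : SOT V W).
Proof.
move=> ST; apply/cvg_SOTP => x; apply: cvg_rnorm.
apply: cvg0_rnorm_le ST => n; rewrite mulrC; exact: (le_opnorm (T - S n)).
Qed.

(** Passing to adjoints does not increase the norm, so norm convergence also
    gives pointwise convergence of the adjoints. *)
Lemma cvg_norm_SOTstar (V W : normedModType R[i]) (T : boundedOp V W)
    (S : nat -> boundedOp V W) :
  rnorm (T - S n) @[n --> \oo] --> (0 : R) ->
  (S n : SOTstar V W) @[n --> \oo] --> (T : SOTstar V W).
Proof.
move=> ST; apply/cvg_SOTstarP; split => [x|phi]; apply: cvg_rnorm.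
  apply: cvg0_rnorm_le ST => n; rewrite mulrC; exact: (le_opnorm (T - S n)).
apply: (cvg0_rnorm_le (M := opnorm phi)) ST => n.
apply: opnorm_le => [|x]; first by rewrite mulr_ge0 ?rnorm_ge0 ?opnorm_ge0.
rewrite [X in rnorm X](_ : _ = phi ((T - S n) x)); last by rewrite linearB.
by rewrite (le_trans (le_opnorm _ _))// -mulrA ler_wpM2l ?opnorm_ge0 ?le_opnorm.
Qed.

Lemma SOT_eval_cvg (V W : normedModType R[i]) (T : SOT V W) x :
  (S : boundedOp V W) x @[S --> T] --> (T : boundedOp V W) x.
Proof. by have /cvg_SOTP := @cvg_id _ (nbhs T); exact. Qed.

Lemma SOTstar_eval_cvg (V W : normedModType R[i]) (T : SOTstar V W) x :
  (S : boundedOp V W) x @[S --> T] --> (T : boundedOp V W) x.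
Proof. by have /cvg_SOTstarP[+ _] := @cvg_id _ (nbhs T); exact. Qed.

End operator_convergence.

(** * Density *)

Section density.
Context {R : realType} (q : R) (q1 : 1 <= q).
Local Notation X := (ellq q1).

(** The coefficients of this operator on the two diagonals next to the main one
    are 1/2; it is a contraction as the mean of two contractions. *)
Definition linking_op : boundedOp X X :=
  (2^-1)%:C *: (shiftr_op q1 + shiftl_op q1).

Lemma linking_P1 : P1 linking_op.
Proof.
split.
  move=> x xP k.
  rewrite boundedOpZ boundedOpD ellqZ ellqD.
  rewrite mulr_ge0 ?ler0c ?invr_ge0// addr_ge0//; last exact: xP.
  by case: k => [|k] //=; exact: xP.
rewrite rnormZ ger0_rnorm ?invr_ge0// mulrC ler_pdivrMr// mul1r.
by rewrite (le_trans (ler_rnormD _ _))// lerD ?rnorm_shiftr ?rnorm_shiftl.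
Qed.

Lemma linking_linked : neighbours_linked linking_op.
Proof.
have h20 : (2^-1)%:C != 0 :> R[i] by rewrite gt_eqF// ltcR invr_gt0.
move=> i; split.
  rewrite boundedOpZ boundedOpD ellqZ ellqD /= /shiftl_fun /= /basis_fun eqxx.
  by rewrite gtn_eqF ?addr0 ?mulr1//; exact: ltnW.
rewrite boundedOpZ boundedOpD ellqZ ellqD /= /shiftl_fun /= /basis_fun eqxx.
case: i => [|i]/=; first by rewrite add0r mulr1.
by rewrite /basis_fun ltn_eqF ?add0r ?mulr1//; exact: ltnW.
Qed.

Definition blend (l : R) (S T : boundedOp X X) : boundedOp X X :=
  (1 - l)%:C *: T + l%:C *: S.

Lemma blend_P1 l S T : 0 <= l <= 1 -> P1 S -> P1 T -> P1 (blend l S T).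
Proof.
move=> /andP[l0 l1] [SP S1] [TP T1]; have l'0 : 0 <= 1 - l by rewrite subr_ge0.
split.
  move=> x xP k.
  rewrite /blend boundedOpD !boundedOpZ ellqD !ellqZ.
  by rewrite addr_ge0// mulr_ge0 ?ler0c//; [exact: TP|exact: SP].
rewrite (le_trans (ler_rnormD _ _))// !rnormZ !ger0_rnorm//.
rewrite [leRHS](_ : 1 = (1 - l) * 1 + l * 1); last by rewrite !mulr1 subrK.
by rewrite lerD// ler_wpM2l.
Qed.

(** Positivity of T prevents cancellation of the nonzero coefficients of S. *)
Lemma blend_linked l S T : 0 < l <= 1 -> P1 S -> P1 T ->
  neighbours_linked S -> neighbours_linked (blend l S T).
Proof.
move=> /andP[l0 l1] [SP _] [TP _] SL.
have H i j : S (basis_vec q1 j) i != 0 -> blend l S T (basis_vec q1 j) i != 0.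
  move=> S0; rewrite /blend boundedOpD !boundedOpZ ellqD !ellqZ.
  rewrite gt_eqF// ltr_wpDl//.
    by rewrite mulr_ge0 ?ler0c ?subr_ge0// TP//; exact: positive_basis.
  by rewrite mulr_gt0 ?ltcR// lt0r S0 SP//; exact: positive_basis.
by move=> i; have [] := SL i; split; exact: H.
Qed.

Lemma blend_cvg S T :
  rnorm (T - blend n.+1%:R^-1 S T) @[n --> \oo] --> (0 : R).
Proof.
have E n : T - blend n.+1%:R^-1 S T = (n.+1%:R^-1)%:C *: (T - S).
  rewrite /blend rmorphB scalerBl scale1r scalerBr opprD opprB addrA.
  by rewrite addrCA subrr addr0.
have -> : (fun n => rnorm (T - blend n.+1%:R^-1 S T)) =
    (fun n => n.+1%:R^-1 * rnorm (T - S)).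
  by apply/funext => n; rewrite E rnormZ ger0_rnorm ?invr_ge0.
rewrite -[X in _ --> X](mul0r (rnorm (T - S))); apply: cvgMl.
exact: cvg_harmonic.
Qed.

(** Only two features of the topology matter: evaluation at each vector is
    continuous (which makes the linked operators a G_delta set), and norm
    convergence implies convergence (which makes them dense).  The maps [op] and
    [mk] pass between Y and the operators, so that Y can be the same type of
    operators carrying either topology. *)
Lemma comeager_not_AAB (Y : topologicalType) (op : Y -> boundedOp X X)
    (mk : boundedOp X X -> Y) : cancel mk op ->
  (forall (T : Y) x, op S x @[S --> T] --> op T x) ->
  (forall (T : Y) (S : nat -> boundedOp X X),
     rnorm (op T - S n) @[n --> \oo] --> (0 : R) ->
     mk (S n) @[n --> \oo] --> T) ->
  comeager [set T : set_type [set T : Y | P1 (op T)] | ~ AAB (op (val T))].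
Proof.
move=> mkK evalC normC.
pose Z := set_type [set T : Y | P1 (op T)].
pose G := [set T : Z | neighbours_linked (op (val T))].
have coordO i j : open [set T : Z | op (val T) (basis_vec q1 j) i != 0].
  pose U := [set T : Y | op T (basis_vec q1 j) i != 0].
  have UO : open U.
    rewrite openE => T /= T0; rewrite /interior.
    (* operators whose value at e_j is closer to that of T than the size of this
       coefficient keep it nonzero *)
    have e0 : 0 < `|op T (basis_vec q1 j) i| by rewrite normr_gt0.
    have /cvgrPdist_lt/(_ _ e0) := evalC T (basis_vec q1 j).
    apply: filterS => S TS; apply/negP => /eqP S0.
    have := le_coord (op T (basis_vec q1 j) - op S (basis_vec q1 j)) i.
    move=> /le_lt_trans/(_ TS).
    by rewrite ellqD ellqN S0 subr0 ltxx.
  by exists U.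
exists G; split.
- exists (fun i => [set T : Z | op (val T) (basis_vec q1 i) i.+1 != 0] `&`
    [set T : Z | op (val T) (basis_vec q1 i.+1) i != 0]).
    by move=> i; apply: openI; exact: coordO.
  by apply/seteqP; split => T /= TG i; [move=> _; exact: TG|exact: TG].
- move=> O [T OT] Oo; have TP : P1 (op (val T)) by have := valP T; rewrite inE.
  have l01 n : 0 < (n.+1%:R^-1 : R) <= 1.
    by rewrite invr_gt0 ltr0n/= invf_le1 ?ler1n.
  pose S n := blend n.+1%:R^-1 linking_op (op (val T)).
  have SP n : mk (S n) \in [set T : Y | P1 (op T)].
    rewrite inE/= mkK; apply: blend_P1 => //; last exact: linking_P1.
    by have /andP[/ltW -> ->] := l01 n.
  have SG n : G (exist _ (mk (S n)) (SP n)).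
    rewrite /G/= mkK; apply: blend_linked => //; first exact: linking_P1.
    exact: linking_linked.
  have : (exist _ (mk (S n)) (SP n) : Z) @[n --> \oo] --> T.
    apply/cvg_initialP; apply: (normC (val T) S); exact: blend_cvg.
  move=> /(_ O (open_nbhs_nbhs (conj Oo OT)))[N _ /(_ _ (leqnn N)) ON].
  by exists (exist _ (mk (S N)) (SP N)).
- move=> T TG; apply: linked_not_AAB => //.
  by have := valP T; rewrite inE.
Qed.

End density.

Local Close Scope complex_scope.

Theorem corollary1p7 (R : realType) (q : R) (q1 : 1 <= q) :
  comeager [set T : P1_SOT q1 | ~ AAB (val T)] /\
  (1 < q -> comeager [set T : P1_SOTstar q1 | ~ AAB (val T)]).
Proof.
split=> [|_].
  apply: (@comeager_not_AAB R q q1 (SOT (ellq q1) (ellq q1)) id id) => //.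
  - exact: SOT_eval_cvg.
  - exact: cvg_norm_SOT.
apply: (@comeager_not_AAB R q q1 (SOTstar (ellq q1) (ellq q1)) id id) => //.
- exact: SOTstar_eval_cvg.
- exact: cvg_norm_SOTstar.
Qed.
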